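(* Assume $\Delta\ne\mathsf{A}_1$. Let $[\mathbf{i}]$ be a commutation class of reduced words for $w_0$. For every vertex $x$ of $\widehat\Upsilon_{[\mathbf{i}]}$ (i.e. $x\in\widehat{\mathsf{R}}$), we have $$\pi(x)+\pi(s_{[\mathbf{i}]}(x))=\sum_{y\in V_{[\mathbf{i}]}(x)}\pi(y),$$ where $\pi:\widehat{\mathsf{R}}\to\mathsf{R}$ denotes the projection onto the first coordinate.
   Context: $\Delta$ is a simply laced Dynkin diagram with vertex set $\Delta_0$; $i\sim j$ means $i,j$ adjacent. $\mathsf{R}$ is its root system, $\alpha_i$ the simple roots, $\mathsf{R}^+$ the positive roots, $N=|\mathsf{R}^+|$, $\mathsf{W}$ the Weyl group generated by the simple reflections $s_i$, $w_0$ the longest element, $i\mapsto i^*$ the involution with $w_0(\alpha_i)=-\alpha_{i^*}$. Reduced words $\mathbf{i}=(i_1,\dots,i_N)$ for $w_0$ are commutation equivalent if related by exchanging consecutive letters that are non-adjacent in $\Delta$; $[\mathbf{i}]$ is the commutation class. $\beta^{\mathbf{i}}_k=s_{i_1}\cdots s_{i_{k-1}}(\alpha_{i_k})$. Repetition quiver. Extend $\mathbf{i}$ to $(i_k)_{k\in\mathbb{Z}}$ by $i_{k+N}=i_k^*$, and set $\widehat\beta^{\mathbf{i}}_{s+tN}=((-1)^t\beta^{\mathbf{i}}_s,-t)$ for $1\le s\le N$, $t\in\mathbb{Z}$. These form $\widehat{\mathsf{R}}=\{(\alpha,k)\in\mathsf{R}\times\mathbb{Z}:(-1)^k\alpha\in\mathsf{R}^+\}$.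 The residue of $\widehat\beta^{\mathbf{i}}_k$ is $i_k$. $\widehat\Upsilon_{[\mathbf{i}]}$ is the quiver with vertex set $\widehat{\mathsf{R}}$ and an arrow $\widehat\beta^{\mathbf{i}}_k\to\widehat\beta^{\mathbf{i}}_l$ whenever $l<k$, $i_k\sim i_l$ and there is no $l<j<k$ with $i_j=i_k$ or $i_j=i_l$. All this depends only on $[\mathbf{i}]$. For $x=\widehat\beta^{\mathbf{i}}_k$, let $k^+$ be the smallest integer $>k$ with $i_{k^+}=i_k$ and $s_{[\mathbf{i}]}(x)=\widehat\beta^{\mathbf{i}}_{k^+}$. The set of abutters $V_{[\mathbf{i}]}(x)$ is the set of vertices $y$ lying on some path from $s_{[\mathbf{i}]}(x)$ to $x$ in $\widehat\Upsilon_{[\mathbf{i}]}$ and whose residue is adjacent in $\Delta$ to the residue of $x$. *)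

(* Defs.v *)
From HB Require Import structures.
From mathcomp Require Import all_boot all_order all_algebra.
From mathcomp Require Import finmap.
From mathcomp Require Import boolp classical_sets functions cardinality fsbigop.

Set Implicit Arguments.
Unset Strict Implicit.
Unset Printing Implicit Defensive.

Import Order.TTheory GRing.Theory Num.Theory.
Local Open Scope classical_set_scope.
Local Open Scope ring_scope.

Variant ade := TypeA of nat | TypeD of nat | TypeE of nat.

Definition ade_rank (X : ade) : nat :=
  match X with TypeA n => n | TypeD n => n | TypeE n => n end.

Definition ade_wf (X : ade) : bool :=
  match X with
  | TypeA n => (1 <= n)%N
  | TypeD n => (4 <= n)%N
  | TypeE n => (6 <= n <= 8)%N
  end.

(* Vertices are 0, ..., n-1.  For D_n and E_n, 0 - 1 - ... - (n-2) is a path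
   and the last vertex n-1 is attached to n-3 (D_n) or to 2 (E_n). *)
Definition ade_edge (X : ade) (a b : nat) : bool :=
  match X with
  | TypeA n => b == a.+1
  | TypeD n => ((b == a.+1) && (b < n.-1)%N)
               || ((a == n - 3)%N && (b == n.-1))
  | TypeE n => ((b == a.+1) && (b < n.-1)%N)
               || ((a == 2%N) && (b == n.-1))
  end.

Definition ade_adj (X : ade) (a b : nat) : bool :=
  ade_edge X a b || ade_edge X b a.

Definition has_type (I : finType) (adj : rel I) (X : ade) : Prop :=
  ade_wf X /\
  exists f : I -> 'I_(ade_rank X),
    bijective f /\ forall i j : I, adj i j = ade_adj X (f i) (f j).

Definition simply_laced_dynkin (I : finType) (adj : rel I) : Prop :=
  exists X : ade, has_type adj X.

(* [v : root_lattice I] stands for the sum of the [v i] times alpha_i. *)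
Definition root_lattice (I : finType) := {ffun I -> int}.

Section Dynkin.
Variables (I : finType) (adj : rel I).
Local Notation Q := (root_lattice I).

Definition simple_root (i : I) : Q := [ffun j => (j == i)%:R].

Definition cartan (i j : I) : int :=
  if i == j then 2 else if adj i j then -1 else 0.

Definition simple_refl (i : I) (v : Q) : Q :=
  v - simple_root i *~ (\sum_(j : I) v j * cartan i j).

(* [:: i_1; ...; i_k] |-> s_{i_1} \o ... \o s_{i_k} *)
Definition word_act (u : seq I) : Q -> Q :=
  foldr (fun (i : I) (f : Q -> Q) => simple_refl i \o f) id u.

(* The simple reflections are involutions, so the group they generate consists
   of their products. *)
Definition weyl : set (Q -> Q) := range word_act.

Definition roots : set Q :=
  [set v | exists2 g, weyl g & exists i : I, v = g (simple_root i)].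

Definition positive_roots : set Q :=
  [set v | roots v /\ forall i : I, 0 <= v i].

Definition num_positive_roots : nat := #|` fset_set positive_roots|%fset.
Local Notation N := num_positive_roots.

Definition reduced_word (g : Q -> Q) (u : seq I) : Prop :=
  word_act u = g /\ forall u' : seq I, word_act u' = g -> (size u <= size u')%N.

Definition longest (w0 : Q -> Q) : Prop :=
  weyl w0 /\
  forall (g : Q -> Q) (u v : seq I),
    reduced_word g u -> reduced_word w0 v -> (size u <= size v)%N.

(* The default value [i] is never used when [w0] is the longest element. *)
Definition star (w0 : Q -> Q) (i : I) : I :=
  odflt i [pick j | w0 (simple_root i) == - simple_root j].

Inductive commutation_equiv : seq I -> seq I -> Prop :=
| comm_refl u : commutation_equiv u u
| comm_step u v i j t :
    ~~ adj i j -> commutation_equiv (u ++ [:: i, j & v]) t ->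
    commutation_equiv (u ++ [:: j, i & v]) t.

Definition commutation_class (w0 : Q -> Q) (C : set (seq I)) : Prop :=
  exists2 w : seq I, reduced_word w0 w & C = [set u | commutation_equiv w u].

(* [ii] is the sequence (i_k), k in Z, extending w = [:: i_1; ...; i_N]. *)
Definition extension (w0 : Q -> Q) (w : seq I) (ii : int -> I) : Prop :=
  (forall k : nat, (k < N)%N -> onth w k = Some (ii k.+1%:Z)) /\
  (forall k : int, ii (k + N%:Z) = star w0 (ii k)).

Definition signed_roots : set (Q * int) :=
  [set x | roots x.1 /\ positive_roots (x.1 *~ ((-1) ^ x.2))].

Section RepetitionQuiver.
Variables (w : seq I) (ii : int -> I).

(* beta_s for 1 <= s <= N *)
Definition beta (s : nat) : Q := word_act (take s.-1 w) (simple_root (ii s%:Z)).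

(* k = s + t N with 1 <= s <= N, i.e. k - 1 = (s - 1) + t N is the Euclidean
   division of k - 1 by N. *)
Definition beta_hat (k : int) : Q * int :=
  let t := ((k - 1) %/ N%:Z)%Z in
  let s := (`|((k - 1) %% N%:Z)%Z|.+1)%N in
  (beta s *~ ((-1) ^ t), - t).

Definition arrow : rel (Q * int) := fun x y =>
  `[< exists k l : int,
        [/\ x = beta_hat k, y = beta_hat l, l < k, adj (ii k) (ii l)
          & forall j : int, l < j -> j < k -> ii j <> ii k /\ ii j <> ii l] >].

Definition next_same_residue (x z : Q * int) : Prop :=
  exists k k' : int,
    [/\ x = beta_hat k, z = beta_hat k', k < k', ii k' = ii k
      & forall j : int, k < j -> j < k' -> ii j <> ii k].

(* s_[i](x): the unique z such that [next_same_residue x z] *)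
Definition succ_vertex (x : Q * int) : Q * int :=
  xget x [set z | next_same_residue x z].

Definition residue_adjacent (x y : Q * int) : Prop :=
  exists k l : int,
    [/\ x = beta_hat k, y = beta_hat l & adj (ii k) (ii l)].

Definition abutters (x : Q * int) : set (Q * int) :=
  [set y | (exists p : seq (Q * int),
              [/\ path arrow (succ_vertex x) p, last (succ_vertex x) p = x
                & y \in succ_vertex x :: p])
           /\ residue_adjacent x y].

End RepetitionQuiver.
End Dynkin.

(* Main.v *)
(* Put b_k = s_{i_1} ... s_{i_(k-1)} (alpha_{i_k}) for all integers k; since
   w_0 s_{i^*} = s_i w_0, one has b_{k+N} = - b_k, so b_k is the first coordinate
   of the k-th vertex.  If k < k^+ are consecutive occurrences of the letter i,
   the vector s_{i_1} ... s_{i_j} (alpha_i) is - b_k for j = k and b_{k^+} for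
   j = k^+ - 1, and in between passing from j - 1 to j adds b_j if i_j is adjacent
   to i and nothing otherwise, whence
     b_k + b_{k^+} = sum of the b_j with k < j < k^+ and i_j adjacent to i.
   These j are exactly the indices of the abutters: paths strictly decrease the
   index, and conversely any two indices whose letters are equal or adjacent are
   joined by a path.  The latter needs an adjacent letter between two occurrences
   of i; otherwise b_k + b_{k^+} = 0, which forces k^+ >= k + N, while every
   letter occurs in any window of length N. *)
Require Import Defs.
From HB Require Import structures.
From mathcomp Require Import all_boot all_order all_algebra.
From mathcomp Require Import finmap.
From mathcomp Require Import boolp classical_sets cardinality fsbigop.
From mathcomp Require Import zify ring.

Set Implicit Arguments.
Unset Strict Implicit.
Unset Printing Implicit Defensive.

Import Order.TTheory GRing.Theory Num.Theory.
Local Open Scope classical_set_scope.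
Local Open Scope ring_scope.

Arguments simple_refl : simpl never.

(** * Simple reflections on the root lattice *)

Section WeylGroup.
Variables (I : finType) (adj : rel I).
Hypotheses (adj_sym : symmetric adj) (adj_irr : irreflexive adj).
Local Notation Q := {ffun I -> int}.
Local Notation alpha := (@simple_root I).
Local Notation cartan := (cartan adj).
Local Notation refl := (simple_refl adj).
Local Notation act := (word_act adj).
Local Notation roots := (Defs.roots adj).
Implicit Types (i j : I) (u v : seq I) (x y r : Q).

(** The value on [x] of the simple coroot of [i]. *)
Definition pairing (i : I) (x : Q) : int := \sum_(j : I) x j * cartan i j.

Arguments pairing : simpl never.

Lemma simple_reflE i x : refl i x = x - alpha i *~ pairing i x.
Proof. by []. Qed.

Lemma ffunMzE x (n : int) i : (x *~ n) i = x i * n.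
Proof.
by case: n => n; rewrite ?NegzE ?mulrNz -?pmulrn ?ffunE ffunMnE;
  rewrite ?mulrN -mulr_natr ?natz.
Qed.

Lemma pairingB i x y : pairing i (x - y) = pairing i x - pairing i y.
Proof.
rewrite /pairing -sumrB; apply: eq_bigr => j _.
by rewrite !ffunE mulrBl.
Qed.

HB.instance Definition _ i :=
  GRing.isZmodMorphism.Build Q int (pairing i) (pairingB i).

Lemma pairing_simple i j : pairing i (alpha j) = cartan i j.
Proof.
rewrite /pairing (bigD1 j) //= big1 ?addr0 => [|k /negbTE kj].
  by rewrite ffunE eqxx mul1r.
by rewrite ffunE kj mul0r.
Qed.

Lemma simple_reflB i x y : refl i (x - y) = refl i x - refl i y.
Proof. by rewrite !simple_reflE pairingB mulrzBr !opprD addrACA. Qed.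

HB.instance Definition _ i :=
  GRing.isZmodMorphism.Build Q Q (simple_refl adj i) (simple_reflB i).

Lemma simple_reflMz i x n : refl i (x *~ n) = refl i x *~ n.
Proof. exact: raddfMz. Qed.

Lemma word_actB u x y : act u (x - y) = act u x - act u y.
Proof. by elim: u => //= i u ->; rewrite raddfB. Qed.

HB.instance Definition _ u :=
  GRing.isZmodMorphism.Build Q Q (word_act adj u) (word_actB u).

Lemma simple_refl_self i : refl i (alpha i) = - alpha i.
Proof.
rewrite simple_reflE pairing_simple /Defs.cartan eqxx.
by rewrite -[2]/(1 + 1) mulrzDr mulr1z opprD addrA subrr sub0r.
Qed.

Lemma simple_refl_simple i j : j != i ->
  refl i (alpha j) = if adj i j then alpha j + alpha i else alpha j.
Proof.
move=> ji; rewrite simple_reflE pairing_simple /Defs.cartan eq_sym (negbTE ji).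
by case: ifP => _; rewrite ?mulrNz ?mulr1z ?opprK ?mulr0z ?subr0.
Qed.

Lemma simple_refl_coord i x k : k != i -> refl i x k = x k.
Proof.
move=> ki; rewrite simple_reflE !ffunE ffunMzE ffunE (negbTE ki).
by rewrite mul0r subr0.
Qed.

Lemma simple_reflK i : involutive (refl i).
Proof.
move=> x; rewrite [X in refl i X]simple_reflE simple_reflB simple_reflMz /=.
by rewrite simple_refl_self simple_reflE mulNrz opprK subrK.
Qed.

Lemma simple_refl_comm i j x : ~~ adj i j ->
  refl i (refl j x) = refl j (refl i x).
Proof.
move=> nij; case: (eqVneq i j) => [->//|ij].
rewrite [refl j x]simple_reflE [refl i x]simple_reflE.
rewrite !simple_reflB !simple_reflMz /=.
have ji : j != i by rewrite eq_sym.
rewrite !simple_refl_simple // [adj j i]adj_sym (negbTE nij).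
by rewrite !simple_reflE addrAC.
Qed.

(** Either side is the reflection in the root [alpha i + alpha j]; [E] expresses it by a formula
    symmetric in the two letters. *)
Lemma simple_refl_braid i j x : adj i j ->
  refl i (refl j (refl i x)) = refl j (refl i (refl j x)).
Proof.
move=> ij; have ji : adj j i by rewrite adj_sym.
have neq : i != j by apply: contraTneq ij => ->; rewrite adj_irr.
have neq' : j != i by rewrite eq_sym.
have E k l : adj k l -> l != k -> refl k (refl l (refl k x)) =
   x - (alpha k + alpha l) *~ (pairing k x + pairing l x).
  move=> kl lk; have lk' : adj l k by rewrite adj_sym.
  have klE : refl k (alpha k + alpha l) = alpha l.
    by rewrite raddfD /= simple_refl_self simple_refl_simple // kl addrC addrK.
  rewrite [refl k x]simple_reflE (simple_reflB l) simple_reflMz.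
  have kl' : k != l by rewrite eq_sym.
  rewrite simple_refl_simple // lk' [refl l x]simple_reflE.
  rewrite !(simple_reflB k) !simple_reflMz klE simple_refl_simple // kl.
  by rewrite simple_reflE; apply/ffunP => m; rewrite !(ffunE, ffunMzE); ring.
by rewrite !E // [alpha i + _]addrC [pairing i x + _]addrC.
Qed.

Lemma word_act_cat u v : act (u ++ v) = act u \o act v.
Proof. by elim: u => //= i u ->. Qed.

Lemma word_act_rcons u i : act (rcons u i) = act u \o refl i.
Proof. by rewrite -cats1 word_act_cat. Qed.

Lemma word_act_rev u : cancel (act u) (act (rev u)).
Proof.
elim: u => //= i u IH x.
by rewrite rev_cons word_act_rcons /= simple_reflK IH.
Qed.

Lemma word_act_revK u : cancel (act (rev u)) (act u).
Proof. by rewrite -{2}[u]revK; apply: word_act_rev. Qed.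

Lemma word_act_coord u x k : k \notin u -> act u x k = x k.
Proof.
elim: u => //= i u IH; rewrite inE negb_or => /andP[ki ku].
by rewrite simple_refl_coord // IH.
Qed.

(** * Invariant form *)

(** The bilinear form whose Gram matrix in the simple roots is the Cartan matrix. *)
Definition form (x y : Q) : int := \sum_(i : I) x i * pairing i y.

Lemma form_sym x y : form x y = form y x.
Proof.
rewrite /form /pairing.
under eq_bigr do rewrite mulr_sumr.
rewrite exchange_big; apply: eq_bigr => i _.
rewrite mulr_sumr; apply: eq_bigr => j _.
have -> : cartan j i = cartan i j by rewrite /Defs.cartan eq_sym adj_sym.
by ring.
Qed.

Lemma formBr z x y : form z (x - y) = form z x - form z y.
Proof.
by rewrite /form -sumrB; apply: eq_bigr => i _; rewrite raddfB mulrBr.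
Qed.

HB.instance Definition _ z :=
  GRing.isZmodMorphism.Build Q int (form z) (formBr z).

Lemma form_simplel i y : form (alpha i) y = pairing i y.
Proof.
rewrite /form (bigD1 i) //= big1 ?addr0 => [|k /negbTE ki].
  by rewrite ffunE eqxx mul1r.
by rewrite ffunE ki mul0r.
Qed.

Lemma form_refl i x y : form (refl i x) (refl i y) = form x y.
Proof.
have formr z t : form z (refl i t) = form z t - pairing i z * pairing i t.
  rewrite simple_reflE raddfB raddfMz /= [form z (alpha i)]form_sym.
  by rewrite form_simplel mulrzz.
rewrite formr form_sym formr [form y x]form_sym simple_reflE raddfB raddfMz /=.
rewrite pairing_simple /Defs.cartan eqxx mulrzz; ring.
Qed.

Lemma form_act u x y : form (act u x) (act u y) = form x y.
Proof. by elim: u => //= i u; rewrite form_refl. Qed.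

(** An isometry conjugates the reflection in a root into the reflection in its image, and opposite
    roots have the same reflection. *)
Lemma word_act_conj u i j x : act u (alpha i) = - alpha j ->
  act u (refl i x) = refl j (act u x).
Proof.
move=> ui; rewrite !simple_reflE raddfB raddfMz /= ui.
rewrite -[pairing i x]form_simplel -(form_act u) ui form_sym raddfN /=.
by rewrite form_sym form_simplel mulNrz mulrNz opprK.
Qed.

(** * Length and positivity *)

Definition nonneg (x : Q) : Prop := forall i, 0 <= x i.

Lemma len_subproof u :
  exists n, `[< exists2 v, size v = n & act v = act u >].
Proof. by exists (size u); apply/asboolP; exists u. Qed.

(** The Coxeter length of the group element represented by [u], not of the word: [len u = size u]
    says that [u] is reduced. *)
Definition len u : nat := ex_minn (len_subproof u).

Lemma lenP u : exists2 v, size v = len u & act v = act u.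
Proof. by rewrite /len; case: ex_minnP => n /asboolP. Qed.

Lemma len_min u v : act v = act u -> (len u <= size v)%N.
Proof.
rewrite /len; case: ex_minnP => n _ min_n uv.
by apply: min_n; apply/asboolP; exists v.
Qed.

Lemma eq_len u v : act u = act v -> len u = len v.
Proof.
have le a b : act a = act b -> (len a <= len b)%N.
  by have [b' <- b'b] := lenP b => ab; apply: len_min; rewrite b'b.
by move=> uv; apply/eqP; rewrite eqn_leq !le.
Qed.

Lemma len_size u : (len u <= size u)%N.
Proof. exact: len_min. Qed.

Lemma len_cat u v : (len (u ++ v) <= len u + len v)%N.
Proof.
have [u' <- u'u] := lenP u; have [v' <- v'v] := lenP v.
by rewrite -size_cat; apply: len_min; rewrite !word_act_cat u'u v'v.
Qed.

Lemma len_rcons u i : (len (rcons u i) <= (len u).+1)%N.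
Proof.
rewrite -cats1 (leq_trans (len_cat _ _)) // -addn1 leq_add2l.
exact: len_size.
Qed.

Lemma word_act_rcons2 u i : act (rcons (rcons u i) i) = act u.
Proof.
by rewrite !word_act_rcons; apply/funext => x /=; rewrite simple_reflK.
Qed.

Lemma len_rcons2 u i : len (rcons (rcons u i) i) = len u.
Proof. exact/eq_len/word_act_rcons2. Qed.

Lemma nonneg_simple i : nonneg (alpha i).
Proof. by move=> k; rewrite ffunE; case: eqP. Qed.

Lemma nonnegD x y : nonneg x -> nonneg y -> nonneg (x + y).
Proof. by move=> x0 y0 k; rewrite ffunE addr_ge0. Qed.

(* The standard induction on length (Humphreys, Reflection groups and Coxeter
   groups, 5.4), carried out in the subgroup generated by [s_i] and the last
   letter [s_j] of a reduced word. *)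
Lemma word_act_nonneg u i : (len u <= len (rcons u i))%N ->
  nonneg (act u (alpha i)).
Proof.
have [n] := ubnP (len u); elim: n u i => // n IH u i ltn le.
have [v vu actv] := lenP u; rewrite -actv.
have lenv : len v = size v by rewrite vu; exact: eq_len.
have {ltn} : (len v < n.+1)%N by rewrite (eq_len actv).
have {le} : (len v <= len (rcons v i))%N.
  rewrite (eq_len actv) (@eq_len (rcons v i) (rcons u i)) //.
  by rewrite !word_act_rcons actv.
clear u vu actv; case: (lastP v) lenv => [_ _ _|{}v j].
  exact: nonneg_simple.
rewrite size_rcons => lenv le; rewrite lenv ltnS => ltn.
have lenv' : len v = size v.
  by apply/eqP; rewrite eqn_leq len_size -ltnS -lenv len_rcons.
have ij : i != j.
  by apply: contraTneq le => ->; rewrite len_rcons2 -ltnNge lenv lenv'.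
rewrite word_act_rcons /= simple_refl_simple //.
have lt_n : (len v < n)%N by rewrite lenv'.
have le_j : (len v <= len (rcons v j))%N by rewrite lenv lenv'.
case: ifPn => [ji|nji].
  have [lei|gti] := leqP (len v) (len (rcons v i)).
    by rewrite raddfD; apply: nonnegD; apply: IH.
  (* Now [v] equals [v2 s_i] with [v2] shorter, so it sends [alpha i + alpha j] to
     [act v2 (alpha j)]. If [v2 s_j] were shorter than [v2], the braid relation
     [v s_j s_i = v2 s_j s_i s_j] would make [v s_j s_i] shorter than [v s_j]. *)
  set v2 := rcons v i in gti.
  have act_v : act v = act v2 \o refl i.
    by rewrite -word_act_rcons word_act_rcons2.
  move: v2 gti act_v => v2 gti act_v.
  have -> : act v (alpha i + alpha j) = act v2 (alpha j).
    rewrite act_v /=; congr (act v2 _).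
    have j_neq_i : j != i by rewrite eq_sym.
    rewrite [LHS]raddfD /= simple_refl_self simple_refl_simple //.
    by rewrite [adj i j]adj_sym ji addrC addrK.
  apply: IH; first exact: ltn_trans lt_n.
  rewrite leqNgt; apply/negP => lt2.
  have E : act (rcons (rcons v j) i) = act (rcons (rcons (rcons v2 j) i) j).
    rewrite !word_act_rcons act_v; apply/funext => x /=.
    by congr (act v2 _); apply: simple_refl_braid; rewrite adj_sym.
  move: le; rewrite (eq_len E) lenv leqNgt => /negP; apply.
  have := len_rcons (rcons (rcons v2 j) i) j; have := len_rcons (rcons v2 j) i.
  by move: lt2 gti; rewrite lenv'; lia.
apply: IH => //; rewrite leqNgt; apply/negP => lti.
have E : act (rcons (rcons v j) i) = act (rcons (rcons v i) j).
  rewrite !word_act_rcons; apply/funext => x /=.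
  by rewrite simple_refl_comm.
move: le; rewrite (eq_len E) lenv leqNgt => /negP; apply.
by have := len_rcons (rcons v i) j; move: lti; rewrite lenv'; lia.
Qed.

Lemma word_act_nonpos u i : (len (rcons u i) <= len u)%N ->
  nonneg (- act u (alpha i)).
Proof.
move=> le; have := @word_act_nonneg (rcons u i) i.
by rewrite len_rcons2 word_act_rcons /= simple_refl_self raddfN; apply.
Qed.

(** * Roots and their signs *)

Lemma roots_act u i : roots (act u (alpha i)).
Proof. by exists (act u); [exists u | exists i]. Qed.

Lemma rootsP r : roots r -> exists u i, r = act u (alpha i).
Proof. by case=> _ [u _ <-] [i ->]; exists u, i. Qed.

Lemma roots_actr u r : roots r -> roots (act u r).
Proof.
move=> /rootsP [v [i ->]].
by rewrite -[act u _]/((act u \o act v) _) -word_act_cat; apply: roots_act.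
Qed.

Lemma roots_sign r : roots r -> nonneg r \/ nonneg (- r).
Proof.
move=> /rootsP[u [i ->]].
have [/word_act_nonneg|/ltnW/word_act_nonpos] := leqP (len u) (len (rcons u i));
  by [left|right].
Qed.

Lemma nonneg_anti r : nonneg r -> nonneg (- r) -> r = 0.
Proof.
move=> r0 r1; apply/ffunP => k; rewrite [RHS]ffunE.
apply/eqP; rewrite eq_le r0 andbT.
by have := r1 k; rewrite ffunE oppr_ge0.
Qed.

Lemma simple_neq0 i : alpha i != 0.
Proof. by apply/eqP => /ffunP/(_ i); rewrite !ffunE eqxx. Qed.

Lemma roots_neq0 r : roots r -> r != 0.
Proof.
move=> /rootsP[u [i ->]]; apply: contra_neq (simple_neq0 i) => ui.
by apply: (can_inj (word_act_rev u)); rewrite ui raddf0.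
Qed.

(* A root that is an integer multiple of [alpha i] is [alpha i] or its opposite
   because the Weyl group preserves divisibility in the root lattice. *)
Lemma refl_nonneg i r : roots r -> nonneg r -> r != alpha i ->
  nonneg (refl i r).
Proof.
move=> rr r0 ri.
have [//|rneg] := roots_sign (roots_actr [:: i] rr).
case/eqP: ri.
(* [refl i] changes only the coordinate at [i]; at the others [r] is both nonnegative and
   nonpositive. *)
have rk k : k != i -> r k = 0.
  move=> ki; apply/eqP; rewrite eq_le r0 andbT.
  by have := rneg k; rewrite /= ffunE simple_refl_coord // oppr_ge0.
have {}rk : r = alpha i *~ r i.
  apply/ffunP => k; rewrite ffunMzE ffunE.
  by case: eqVneq => [->|/rk->]; rewrite ?mul1r ?mul0r.
have [u [j ruj]] := rootsP rr.
have : (act (rev u) (alpha i) *~ r i) j = 1.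
  by rewrite -raddfMz -rk ruj /= word_act_rev ffunE eqxx.
rewrite ffunMzE => E.
suff ri1 : r i = 1 by rewrite rk ri1.
move: (r0 i) E; set a := act _ _ _; set b := r i.
by have [a0|a1] := leP a 0; nia.
Qed.

(** * Inversion roots of a word *)

(** The roots [beta_k] of the word in order; for reduced [u] they are the positive roots that the
    inverse of [act u] makes negative. *)
Fixpoint inv_roots (u : seq I) : seq Q :=
  if u is i :: u' then alpha i :: map (refl i) (inv_roots u') else [::].

Lemma size_inv_roots u : size (inv_roots u) = size u.
Proof. by elim: u => //= i u; rewrite size_map => ->. Qed.

Lemma nth_inv_roots u k i : onth u k = Some i ->
  nth 0 (inv_roots u) k = act (take k u) (alpha i).
Proof.
elim: u k => [|j u IH] [|k] //=; first by case=> ->.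
move=> ki; rewrite (nth_map 0) ?size_inv_roots ?IH //.
by rewrite -onthTE ki.
Qed.

Lemma inv_rootsP u r : r \in inv_roots u ->
  exists k i, onth u k = Some i /\ r = act (take k u) (alpha i).
Proof.
move=> /(nthP 0)[k]; rewrite size_inv_roots => ku <-.
case E: (onth u k) => [i|]; last by rewrite -onthTE E in ku.
by exists k, i; split=> //; apply: nth_inv_roots.
Qed.

Lemma reduced_cat u v : len (u ++ v) = size (u ++ v) ->
  len u = size u /\ len v = size v.
Proof.
move=> E; have := len_cat u v; rewrite E size_cat.
by have := len_size u; have := len_size v; lia.
Qed.

(** Prefixes of a reduced word are reduced, so each new letter increases the length and
    [word_act_nonneg] applies. *)
Lemma inv_roots_pos u r : len u = size u -> r \in inv_roots u ->
  roots r /\ nonneg r.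
Proof.
move=> red /inv_rootsP[k [i [ki ->]]]; split; first exact: roots_act.
have ku : (k < size u)%N by rewrite -onthTE ki.
have E : u = rcons (take k u) i ++ drop k.+1 u.
  by rewrite -(@onth_nth _ i _ _ _ ki) -take_nth // cat_take_drop.
apply: word_act_nonneg.
have [|-> _] := @reduced_cat (rcons (take k u) i) (drop k.+1 u).
  by rewrite -E.
by rewrite size_rcons (leq_trans (len_size _)).
Qed.

(** If the head [alpha i] recurred as [refl i r], then [r] would be [- alpha i], although it is an
    inversion root of the reduced tail and hence positive. *)
Lemma inv_roots_uniq u : len u = size u -> uniq (inv_roots u).
Proof.
elim: u => //= i u IH red.
have [_ redu] := @reduced_cat [:: i] u red.
rewrite (map_inj_uniq (can_inj (simple_reflK i))) IH // andbT.
apply/negP => /mapP[r ru ri].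
have [_ r0] := inv_roots_pos redu ru.
have rE : r = - alpha i by rewrite -[r](simple_reflK i) -ri simple_refl_self.
have /eqP[] := simple_neq0 i.
by apply: nonneg_anti; [exact: nonneg_simple | rewrite -rE].
Qed.

(** Apply the letters of [u] to [r] one by one: the sign must change at some letter, and [s_i]
    changes the sign of no positive root but [alpha i]. *)
Lemma mem_inv_roots u r : roots r -> nonneg r ->
  nonneg (- act (rev u) r) -> r \in inv_roots u.
Proof.
elim: u r => [|i u IH] r rr r0.
  by move=> /(nonneg_anti r0)/eqP; rewrite (negbTE (roots_neq0 rr)).
rewrite rev_cons word_act_rcons /= inE => neg.
have [//|ri /=] := eqVneq r (alpha i).
rewrite -[r](simple_reflK i); apply/map_f/IH => //.
  exact: (roots_actr [:: i]).
exact: refl_nonneg.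
Qed.

(** * The longest element *)

Lemma sum_simple x : x = \sum_i alpha i *~ x i.
Proof.
apply/ffunP => k; rewrite sum_ffunE (bigD1 k) //= big1 => [|j /negbTE jk].
  by rewrite ffunMzE ffunE eqxx mul1r addr0.
by rewrite ffunMzE ffunE eq_sym jk mul0r.
Qed.

Lemma word_act_le0 u x : (forall i, nonneg (- act u (alpha i))) -> nonneg x ->
  nonneg (- act u x).
Proof.
move=> neg x0 k; rewrite [x]sum_simple raddf_sum -sumrN sum_ffunE.
apply: sumr_ge0 => i _; rewrite raddfMz -mulNrz ffunMzE.
by apply: mulr_ge0; [exact: neg | exact: x0].
Qed.

(** A nonempty reduced word makes the simple root of its last letter negative. *)
Lemma word_act_id u : (forall i, nonneg (act u (alpha i))) -> act u = id.
Proof.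
move=> pos; have [v vu actv] := lenP u.
have lenv : len v = size v by rewrite vu; exact: eq_len.
rewrite -actv in pos *; case: (lastP v) lenv pos => [//|{u actv vu}v i].
rewrite size_rcons => lenv /(_ i) pos.
have /eqP[] := roots_neq0 (roots_act (rcons v i) i).
apply: nonneg_anti pos _; apply: word_act_nonpos.
by rewrite len_rcons2 lenv (leq_trans (len_size _)).
Qed.

Section LongestElement.
Variable w : seq I.
Hypotheses (w_red : len w = size w) (w_max : forall u, (len u <= len w)%N).

Lemma w0_neg i : nonneg (- act w (alpha i)).
Proof. exact/word_act_nonpos/w_max. Qed.

Lemma w0V_neg i : nonneg (- act (rev w) (alpha i)).
Proof.
have [r0|//] := roots_sign (roots_act (rev w) i).
have /eqP[] := simple_neq0 i; apply: nonneg_anti; first exact: nonneg_simple.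
rewrite -[alpha i](word_act_revK w).
by apply: word_act_le0 => //; apply: w0_neg.
Qed.

(** Take [g = - w_0 alpha_i] and [j] in its support, so that [g - alpha j] is still nonnegative. As
    [- w_0^{-1}] preserves nonnegativity, the nonzero vector [d = - w_0^{-1} alpha_j] satisfies
    [0 <= d <= alpha i], whence [d = alpha i]. *)
Lemma w0_simple i : exists j, act w (alpha i) = - alpha j.
Proof.
have [g gE] : exists g, g = - act w (alpha i) by eexists.
have g0 : nonneg g by rewrite gE; apply: w0_neg.
have gN0 : g != 0 by rewrite gE oppr_eq0 roots_neq0 //; exact: roots_act.
have [j gj] : exists j, g j != 0.
  apply: contrapT => ng; case/eqP: gN0; apply/ffunP => j; rewrite [RHS]ffunE.
  by apply: contrapT => /eqP gj; apply: ng; exists j.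
have [d defd] : exists d, d = - act (rev w) (alpha j) by eexists.
have d0 : nonneg d by rewrite defd; apply: w0V_neg.
have dN0 : d != 0 by rewrite defd oppr_eq0 roots_neq0 //; exact: roots_act.
have id0 : nonneg (alpha i - d).
  have -> : alpha i - d = - act (rev w) (g - alpha j).
    have gV : act (rev w) g = - alpha i by rewrite gE raddfN /= word_act_rev.
    by rewrite word_actB gV defd opprB !opprK addrC.
  apply: word_act_le0 => [|k]; first exact: w0V_neg.
  rewrite !ffunE; case: eqVneq => [->|_]; last by rewrite subr0 g0.
  by rewrite subr_ge0 -gtz0_ge1 lt_def gj g0.
have dE : d = alpha i *~ d i.
  apply/ffunP => k; rewrite ffunMzE ffunE; case: eqVneq => [->|ki].
    by rewrite mul1r.
  apply/eqP; rewrite mul0r eq_le d0 andbT.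
  by have := id0 k; rewrite !ffunE (negbTE ki) sub0r oppr_ge0.
have di : d i = 1.
  have din0 : d i != 0 by apply: contra_neq dN0 => di; rewrite dE di.
  by have := id0 i; move: (d0 i) din0; rewrite !ffunE eqxx /=; lia.
exists j; rewrite -[alpha i]mulr1z -di -dE defd.
by rewrite raddfN /= word_act_revK.
Qed.

Lemma starP i : act w (alpha i) = - alpha (star (act w) i).
Proof.
rewrite /star; case: pickP => [j /eqP //|none].
by have [j /eqP] := w0_simple i; rewrite none.
Qed.

(** The square sends simple roots to simple roots, and only the identity keeps all of them
    nonnegative. *)
Lemma w0_involutive : involutive (act w).
Proof.
have E : act (w ++ w) = id.
  apply: word_act_id => i; rewrite word_act_cat /= starP raddfN /= starP opprK.
  exact: nonneg_simple.
by move=> x; rewrite -[RHS]/(id x) -E word_act_cat.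
Qed.

Lemma starV i : act w (alpha (star (act w) i)) = - alpha i.
Proof.
by rewrite -[alpha (star _ _)]opprK -starP raddfN /= w0_involutive.
Qed.

Lemma w0_conj i x : act w (refl (star (act w) i) x) = refl i (act w x).
Proof. exact/word_act_conj/starV. Qed.

(** A word without [i] preserves the coordinate at [i], whereas [w_0] makes [alpha i] negative. *)
Lemma mem_longest i : i \in w.
Proof.
apply: contraT => iw; have := w0_neg i i.
by rewrite !ffunE (word_act_coord _ iw) ffunE eqxx.
Qed.

Lemma positive_rootsE : positive_roots adj = [set` inv_roots w].
Proof.
apply/seteqP; split => r /=.
  move=> [rr r0]; apply: mem_inv_roots => //.
  by apply: word_act_le0 r0; apply: w0V_neg.
by move/(inv_roots_pos w_red).
Qed.

Lemma num_positive_rootsE : num_positive_roots adj = size w.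
Proof.
rewrite /num_positive_roots positive_rootsE.
have -> : [set` inv_roots w] = [set` [fset r in inv_roots w]%fset].
  by apply/seteqP; split => r /=; rewrite inE.
by rewrite set_fsetK card_fseq undup_id ?inv_roots_uniq // size_inv_roots.
Qed.

End LongestElement.

(** * The extended sequence of letters and its roots *)

Section RepetitionQuiver.
Variables (w : seq I) (ii : int -> I).
Hypotheses (w_red : len w = size w) (w_max : forall u, (len u <= len w)%N).
Hypothesis ii_ext : extension adj (act w) w ii.
Local Notation N := (num_positive_roots adj).

(* A word for [s_{i_1} ... s_{i_k}], read as [s_{i_0} ... s_{i_(k+1)}] when
   [k < 0]. *)
Definition partial_word (k : int) : seq I :=
  match k with
  | Posz n => [seq ii m.+1%:Z | m <- iota 0 n]
  | Negz n => [seq ii (- m%:Z) | m <- iota 0 n.+1]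
  end.

(** The root [b_k], without the window and the sign of [beta_hat]; the prefix stops just before
    position [k]. *)
Definition root_at (k : int) : Q := act (partial_word (k - 1)) (alpha (ii k)).

(** For [k > 0] a letter is appended. For [k <= 0] the word for [k - 1] is one letter longer, ending
    in [ii k], and the extra reflection cancels that letter. *)
Lemma partial_wordE k :
  act (partial_word k) = act (partial_word (k - 1)) \o refl (ii k).
Proof.
rewrite -word_act_rcons; case: k => [[|n]|n].
- by rewrite -(word_act_rcons2 [::] (ii 0)).
- have -> : n.+1%:Z - 1 = n by lia.
  rewrite /partial_word -{1}[n.+1]addn1 iotaD map_cat cats1 add0n.
  by [].
have -> : Negz n - 1 = Negz n.+1 by lia.
rewrite -[LHS](word_act_rcons2 _ (ii (Negz n))); congr (act (rcons _ _)).
rewrite [RHS]/partial_word -[n.+2]addn1 iotaD map_cat cats1 add0n NegzE.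
by congr rcons; lia.
Qed.

Lemma size_longest : N = size w.
Proof. exact: num_positive_rootsE. Qed.

Lemma onth_w k : (k < size w)%N -> onth w k = Some (ii k.+1%:Z).
Proof. by rewrite -size_longest; case: ii_ext => + _; apply. Qed.

Lemma star_ii (k : int) : ii (k + N%:Z) = star (act w) (ii k).
Proof. by case: ii_ext. Qed.

Lemma take_w k : (k <= size w)%N -> take k w = partial_word k%:Z.
Proof.
move=> kw; apply: (@eq_from_nth _ (ii 0)) => [|j]; rewrite size_takel //.
  by rewrite size_map size_iota.
move=> jk; rewrite nth_take // (nth_map 0%N) ?size_iota // nth_iota // add0n.
exact/onth_nth/onth_w/(leq_trans jk).
Qed.

(** Since [w_0 s_{i^*} = s_i w_0], the identities at [k - 1] and at [k] are equivalent; the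
    induction runs in both directions from [k = 0], where the prefix of length [N] is [w]. *)
Lemma partial_wordN (k : int) :
  act (partial_word (k + N%:Z)) = act (partial_word k) \o act w.
Proof.
have step (l : int) :
    act (partial_word (l - 1 + N%:Z)) = act (partial_word (l - 1)) \o act w <->
    act (partial_word (l + N%:Z)) = act (partial_word l) \o act w.
  have El : act (partial_word (l + N%:Z)) =
      act (partial_word (l - 1 + N%:Z)) \o refl (star (act w) (ii l)).
    by rewrite partial_wordE star_ii addrAC.
  split=> E.
    rewrite El E [act (partial_word l)]partial_wordE; apply/funext => x /=.
    by rewrite (w0_conj w_red w_max).
  apply/funext => x.
  rewrite -[x](simple_reflK (star (act w) (ii l))).
  rewrite -[LHS]/((act (partial_word (l - 1 + N%:Z)) \o refl _) _) -El E.
  rewrite [act (partial_word l)]partial_wordE /=.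
  by rewrite (w0_conj w_red w_max) !simple_reflK.
elim/int_ind: k => [|n IH|n IH].
- by rewrite add0r size_longest -take_w // take_size.
- by apply/step; rewrite -addn1 PoszD addrK.
- have -> : - n.+1%:Z = - n%:Z - 1 by lia.
  exact/step.
Qed.

Lemma root_atN (k : int) : root_at (k + N%:Z) = - root_at k.
Proof.
rewrite /root_at addrAC partial_wordN star_ii /=.
by rewrite (starV w_red w_max) raddfN.
Qed.

Lemma root_at_period (k t : int) :
  root_at (k + t * N%:Z) = root_at k *~ (-1) ^ t.
Proof.
have m1 : (-1 : int) \is a GRing.unit by [].
elim/int_ind: t => [|n IH|n IH].
- by rewrite mul0r addr0 expr0z.
- rewrite -addn1 PoszD mulrDl mul1r addrA root_atN IH exprzDr // expr1z.
  by rewrite mulrN1 mulrNz.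
rewrite -[LHS]opprK -root_atN.
have -> : k + - n.+1%:Z * N%:Z + N%:Z = k + - n%:Z * N%:Z by lia.
have -> : - n.+1%:Z = - n%:Z + -1 by lia.
by rewrite IH exprzDr // exprN1 invrN1 mulrN1 mulrNz.
Qed.

Lemma betaE s : (s < size w)%N -> beta adj w ii s.+1 = root_at s.+1%:Z.
Proof.
move=> sw; have sE : s.+1%:Z - 1 = s%:Z by lia.
by rewrite /beta /root_at sE succnK take_w // ltnW.
Qed.

Lemma root_at_nth s : (s < size w)%N -> root_at s.+1%:Z = nth 0 (inv_roots w) s.
Proof.
by move=> sw; rewrite (nth_inv_roots (onth_w sw)) -betaE.
Qed.

Lemma size_w_gt0 (i : I) : (0 < size w)%N.
Proof. by case: w (mem_longest w_max i). Qed.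

(** * Vertices indexed by the integers *)

Lemma int_window (k : int) :
  exists t s, (s < size w)%N /\ k = s.+1%:Z + t * N%:Z.
Proof.
(* The letter [ii 0] shows that [I] is inhabited, so [N] is nonzero and the division makes sense.
   Here [s] counts from 0. *)
have w0 := size_w_gt0 (ii 0).
exists ((k - 1) %/ N%:Z)%Z, `|((k - 1) %% N%:Z)%Z|%N.
have N0 : N%:Z != 0 by rewrite size_longest; lia.
have := modz_ge0 (k - 1) N0; have := ltz_mod (k - 1) N0.
by have := divz_eq (k - 1) N%:Z; rewrite size_longest; split; lia.
Qed.

Lemma beta_hatE (t : int) s : (s < size w)%N ->
  beta_hat adj w ii (s.+1%:Z + t * N%:Z) = (root_at (s.+1%:Z + t * N%:Z), - t).
Proof.
move=> sw; rewrite /beta_hat.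
have -> : s.+1%:Z + t * N%:Z - 1 = t * N%:Z + s%:Z by lia.
have N0 : N%:Z != 0 by rewrite size_longest; lia.
have s0 : 0 <= s%:Z < `|N%:Z| by rewrite size_longest; lia.
rewrite divzMDl // modzMDl modz_small ?divz_small //.
by rewrite addr0 /= betaE // [in RHS]root_at_period.
Qed.

Lemma beta_hat1 k : (beta_hat adj w ii k).1 = root_at k.
Proof. by have [t [s [sw ->]]] := int_window k; rewrite beta_hatE. Qed.

Lemma root_at_inj s s' : (s < size w)%N -> (s' < size w)%N ->
  root_at s.+1%:Z = root_at s'.+1%:Z -> s = s'.
Proof.
move=> sw sw'; rewrite !root_at_nth // => /eqP.
rewrite nth_uniq ?size_inv_roots //; first by move/eqP.
exact: inv_roots_uniq.
Qed.

Lemma root_at_pos s : (s < size w)%N ->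
  roots (root_at s.+1%:Z) /\ nonneg (root_at s.+1%:Z).
Proof.
move=> sw; rewrite root_at_nth //; apply: (inv_roots_pos w_red).
by rewrite mem_nth // size_inv_roots.
Qed.

Lemma sign_cases (t : int) : (-1) ^ t = 1 :> int \/ (-1) ^ t = - (1 : int).
Proof.
case: t => n; rewrite ?NegzE -?exprnN -?exprnP -signr_odd.
  by case: odd; [right|left].
by case: odd; [right|left].
Qed.

(** The second coordinate determines the window, and inside a window the roots are distinct. Thus a
    vertex determines its index and its residue. *)
Lemma beta_hat_inj : injective (beta_hat adj w ii).
Proof.
move=> k l; have [t [s [sw ->]]] := int_window k.
have [t' [s' [sw' ->]]] := int_window l.
rewrite !beta_hatE // => -[E tt']; move/oppr_inj: tt' E => <-.
rewrite !root_at_period => E; congr (_ + _); congr (_.+1%:Z).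
apply: root_at_inj => //.
by case: (sign_cases t) E => ->; rewrite ?mulrNz ?mulr1z // => /oppr_inj.
Qed.

Lemma beta_hat_onto (z : Q * int) :
  signed_roots adj z -> exists k, z = beta_hat adj w ii k.
Proof.
case: z => a m [/= _]; rewrite (positive_rootsE w_red w_max) /=.
move=> /(nthP 0)[s]; rewrite size_inv_roots => sw.
rewrite -root_at_nth // => E; exists (s.+1%:Z + - m * N%:Z).
rewrite beta_hatE // opprK root_at_period E -mulrzA -exprzDr // subrr.
by rewrite expr0z mulr1z.
Qed.

(** Up to a common sign, each window lists the same distinct positive roots in the same order.
    Opposite roots thus sit at the same place of different windows, a nonzero multiple of [N]
    apart. *)
Lemma root_at_opp (k l : int) :
  k < l -> root_at l = - root_at k -> k + N%:Z <= l.
Proof.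
have [t [s [sw ->]]] := int_window k; have [t' [s' [sw' ->]]] := int_window l.
move=> kl; rewrite !root_at_period => E.
have [rs s0] := root_at_pos sw; have [_ s'0] := root_at_pos sw'.
have [opp|[eq_s tt']] : root_at s'.+1%:Z = - root_at s.+1%:Z \/
    root_at s.+1%:Z = root_at s'.+1%:Z /\ t <> t'.
- have [tt'|tt'] := eqVneq t t'.
    left; case: (sign_cases t) E; rewrite -tt' => ->;
      by rewrite ?mulrNz ?mulr1z // => /oppr_inj.
  case: (sign_cases t) (sign_cases t') E => -> [] ->;
    rewrite ?mulrNz ?mulr1z ?opprK => E;
    [left|right|right|left]; rewrite -?E ?opprK //; split=> //; try exact/eqP.
  exact/oppr_inj.
- by case/eqP: (roots_neq0 rs); apply: nonneg_anti; rewrite -?opp.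
have ss' := root_at_inj sw sw' eq_s; move: kl; rewrite -ss'.
have : (0 < N)%N by rewrite size_longest; lia.
by nia.
Qed.

Lemma partial_word_cat (k : int) n :
  act (partial_word (k + n%:Z)) =
  act (partial_word k) \o act [seq ii (k + m.+1%:Z) | m <- iota 0 n].
Proof.
elim: n => [|n IH]; first by rewrite addr0.
rewrite partial_wordE.
have -> : k + n.+1%:Z - 1 = k + n%:Z by lia.
rewrite IH; have -> : iota 0 n.+1 = rcons (iota 0 n) n.
  by rewrite -{1}[n.+1]addn1 iotaD cats1.
by rewrite map_rcons word_act_rcons.
Qed.

(** Cancelling the prefix up to [k - 1] shows that any [N] consecutive letters spell [w_0], so the
    argument of [mem_longest] applies. *)
Lemma mem_window (k : int) i :
  exists l : int, [/\ k <= l, l < k + N%:Z & ii l = i].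
Proof.
pose v := [seq ii (k - 1 + m.+1%:Z) | m <- iota 0 N].
have actv : act v = act w.
  apply/funext => x; apply: (can_inj (word_act_rev (partial_word (k - 1)))).
  have /(congr1 (@^~ x)) /= := partial_wordN (k - 1).
  by rewrite partial_word_cat.
have : i \in v.
  apply: contraT => iv; have := w0_neg w_max i i.
  by rewrite -actv !ffunE (word_act_coord _ iv) ffunE eqxx.
move=> /mapP[m]; rewrite mem_iota => mN ->.
by exists (k - 1 + m.+1%:Z); split => //; lia.
Qed.

(** * The mesh relation between consecutive occurrences of a letter *)

Lemma partial_word_simple (k : int) (d : nat) i :
  (forall m : nat, (m < d)%N -> ii (k + m.+1%:Z) != i) ->
  act (partial_word (k + d%:Z)) (alpha i) = act (partial_word k) (alpha i) +
    \sum_(0 <= m < d | adj i (ii (k + m.+1%:Z))) root_at (k + m.+1%:Z).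
Proof.
elim: d => [|d IH] neq; first by rewrite big_geq // !addr0.
have {}IH := IH (fun m md => neq m (ltnW md)).
have kE : k + d.+1%:Z - 1 = k + d%:Z by lia.
rewrite big_mkcond big_nat_recr //= -big_mkcond addrA -IH partial_wordE kE /=.
have di : i != ii (k + d.+1%:Z) by rewrite eq_sym neq.
rewrite simple_refl_simple // [adj (ii _) i]adj_sym.
by case: ifP => _; rewrite ?addr0 // raddfD /= /root_at kE.
Qed.

Lemma root_at_mesh (k : int) (d : nat) :
  (forall m : nat, (m < d)%N -> ii (k + m.+1%:Z) != ii k) ->
  ii (k + d.+1%:Z) = ii k ->
  root_at k + root_at (k + d.+1%:Z) =
  \sum_(0 <= m < d | adj (ii k) (ii (k + m.+1%:Z))) root_at (k + m.+1%:Z).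
Proof.
move=> neq eq_ii; rewrite {2}/root_at eq_ii.
have -> : k + d.+1%:Z - 1 = k + d%:Z by lia.
rewrite partial_word_simple // partial_wordE /= simple_refl_self raddfN /=.
by rewrite addrA subrr add0r.
Qed.

(** The gap is [d.+1], so that the positions strictly inside it are the [k + m.+1] with [m < d], as
    in [root_at_mesh]. *)
Lemma next_letter (k l : int) : k < l -> ii l = ii k ->
  exists d : nat, [/\ k + d.+1%:Z <= l, ii (k + d.+1%:Z) = ii k
    & forall m : nat, (m < d)%N -> ii (k + m.+1%:Z) != ii k].
Proof.
move=> kl lk; have ex : exists d : nat, ii (k + d.+1%:Z) == ii k.
  exists `|l - k|.-1%N; apply/eqP; rewrite -[RHS]lk; congr ii; lia.
case: (ex_minnP ex) => d /eqP dk min_d; exists d; split=> //.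
  have : (d <= `|l - k|.-1)%N.
    by apply: min_d; apply/eqP; rewrite -[RHS]lk; congr ii; lia.
  by lia.
by move=> m md; apply: contraL md => /min_d; rewrite -leqNgt.
Qed.

Lemma adjacent_between (k l : int) i : k < l -> ii l = ii k -> adj (ii k) i ->
  exists m : int, [/\ k < m, m < l & adj (ii k) (ii m)].
Proof.
move=> kl /(next_letter kl)[d [dl dk neq]] ki; apply: contrapT => none.
have nadj m : (m < d)%N -> ~~ adj (ii k) (ii (k + m.+1%:Z)).
  move=> md; apply/negP => km; apply: none.
  by exists (k + m.+1%:Z); split=> //; lia.
have := root_at_mesh neq dk; rewrite big_nat_cond big1; last first.
  by move=> m /andP[/= md]; rewrite (negbTE (nadj _ md)).
move=> /eqP; rewrite addrC addr_eq0 => /eqP /root_at_opp kN.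
(* The neighbour [i] occurs among the [N] positions starting at [k]; it is not at [k] itself, and
   the next occurrence of [ii k] comes only after them. *)
have [m [km mN mi]] := mem_window k i; apply: none; exists m.
have mk : m != k by apply: contraTneq ki => mk; rewrite -mi mk adj_irr.
by rewrite mi; split=> //; move: kN mk; lia.
Qed.

(** * Paths in the repetition quiver *)

Local Notation bhat := (beta_hat adj w ii).
Local Notation arrow := (arrow adj w ii).

Definition connected_by_path (a b : Q * int) : Prop :=
  exists2 p, path arrow a p & last a p = b.

Lemma connected_trans (b a c : Q * int) :
  connected_by_path a b -> connected_by_path b c -> connected_by_path a c.
Proof.
move=> [p ap <-] [q bq <-]; exists (p ++ q); last by rewrite last_cat.
by rewrite cat_path ap.
Qed.

(* Consecutive occurrences of a letter have an adjacent letter in between, so any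
   gap that is not an arrow can be subdivided. *)
Lemma connected_bhat (k l : int) : k < l ->
  adj (ii l) (ii k) \/ (ii l = ii k /\ exists i, adj (ii k) i) ->
  connected_by_path (bhat l) (bhat k).
Proof.
have [n] := ubnP `|l - k|%N; elim: n k l => // n IH k l lt_n kl.
case=> [lk|[lk [i ki]]]; last first.
  have [m [km ml kmadj]] := adjacent_between kl lk ki.
  apply: (@connected_trans (bhat m)).
    by apply: IH => //; [lia | left; rewrite lk].
  by apply: IH => //; [lia | left; rewrite adj_sym].
have [[m [km ml mE]]|none] :=
    EM (exists m : int, [/\ k < m, m < l & ii m = ii l \/ ii m = ii k]).
  apply: (@connected_trans (bhat m)); apply: IH => //; try lia.
    by case: mE => ->; [right; split=> //; exists (ii k)|left].
  by case: mE => ->; [left|right; split=> //; exists (ii l); rewrite adj_sym].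
exists [:: bhat k] => //=; rewrite andbT; apply/asboolP; exists l, k.
by split=> // m km ml; split=> mE; apply: none; exists m; split; auto.
Qed.

(** Arrows strictly decrease the index, which is well defined by [beta_hat_inj]. *)
Lemma path_bhat (k l : int) p (b : Q * int) : path arrow (bhat l) p ->
  last (bhat l) p = bhat k -> b \in bhat l :: p ->
  exists m : int, [/\ b = bhat m, k <= m & m <= l].
Proof.
elim: p l b => [|a p IH] l b /=.
  by move=> _ /beta_hat_inj <-; rewrite inE => /eqP ->; exists l.
move=> /andP[/asboolP[k' [l' [/beta_hat_inj <- -> l'l _ _]]] pp] lastp.
rewrite inE => /predU1P[->|bp].
  have [m [_ km ml]] := IH _ _ pp lastp (mem_head _ _).
  by exists l; split=> //; lia.
have [m [bE km ml]] := IH _ _ pp lastp bp.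
by exists m; split=> //; lia.
Qed.

(** * Abutters of the vertex at [k], with [k + d.+1] in the role of the successor index *)

Section Abutters.
Variables (k : int) (d : nat).
Hypotheses (ii_d : ii (k + d.+1%:Z) = ii k)
  (ii_neq : forall m : nat, (m < d)%N -> ii (k + m.+1%:Z) != ii k).

Lemma ii_between (j : int) : k < j -> j < k + d.+1%:Z -> ii j <> ii k.
Proof.
move=> kj jd; have -> : j = k + `|j - k|.-1.+1%:Z by lia.
by apply/eqP/ii_neq; lia.
Qed.

Lemma succ_vertexE : succ_vertex adj w ii (bhat k) = bhat (k + d.+1%:Z).
Proof.
apply: xget_unique => [|z [k1 [k' [/beta_hat_inj <- -> kk' k'k nk']]]].
  exists k, (k + d.+1%:Z); split=> //; first by lia.
  exact: ii_between.
congr bhat; apply/eqP; rewrite eq_le; apply/andP; split.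
  by rewrite leNgt; apply/negP => dk'; apply: (nk' (k + d.+1%:Z)) => //; lia.
by rewrite leNgt; apply/negP => k'd; apply: (ii_between kk').
Qed.

Lemma abuttersE : abutters adj w ii (bhat k) =
  [set` [seq bhat (k + m.+1%:Z) |
           m <- index_iota 0 d & adj (ii k) (ii (k + m.+1%:Z))]].
Proof.
apply/seteqP; split => y /=.
  rewrite /abutters /= succ_vertexE.
  move=> [[p [pp lp /(path_bhat pp lp)[m [-> km ml]]]]].
  move=> [k1 [m1 [/beta_hat_inj <- /beta_hat_inj <- km_adj]]].
  (* Both ends carry the letter [ii k], which is not adjacent to itself. *)
  have mk : m != k by apply: contraTneq km_adj => ->; rewrite adj_irr.
  have md : m != k + d.+1%:Z.
    by apply: contraTneq km_adj => ->; rewrite ii_d adj_irr.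
  have mE : m = k + `|m - k|.-1.+1%:Z by lia.
  apply/mapP; exists `|m - k|.-1; last by rewrite -mE.
  by rewrite mem_filter -mE km_adj mem_index_iota; lia.
move=> /mapP[m]; rewrite mem_filter mem_index_iota => /andP[km md] ->.
split; last by exists k, (k + m.+1%:Z).
rewrite succ_vertexE.
(* A path through the given vertex is glued from two paths between adjacent letters. *)
have [p pp lp] : connected_by_path (bhat (k + d.+1%:Z)) (bhat (k + m.+1%:Z)).
  by apply: connected_bhat; [lia | left; rewrite ii_d].
have [q qq lq] : connected_by_path (bhat (k + m.+1%:Z)) (bhat k).
  by apply: connected_bhat; [lia | left; rewrite adj_sym].
exists (p ++ q); rewrite cat_path last_cat lp pp; split=> //.
by rewrite -cat_cons mem_cat -lp mem_last.
Qed.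

Lemma abutters_sum :
  (bhat k).1 + (succ_vertex adj w ii (bhat k)).1 =
  \sum_(y \in abutters adj w ii (bhat k)) y.1.
Proof.
(* Distinct indices give distinct vertices, so the sum over the set of abutters becomes a sum over
   indices. *)
rewrite succ_vertexE abuttersE -fsbig_seq; last first.
  rewrite map_inj_uniq ?filter_uniq ?iota_uniq // => m m' /beta_hat_inj.
  by lia.
rewrite big_map big_filter !beta_hat1 root_at_mesh //.
by apply: eq_bigr => m _; rewrite beta_hat1.
Qed.

End Abutters.

Lemma signed_roots_mesh (z : Q * int) : signed_roots adj z ->
  z.1 + (succ_vertex adj w ii z).1 = \sum_(y \in abutters adj w ii z) y.1.
Proof.
move=> /beta_hat_onto[k ->].
(* Starting the window at [k + 1] yields an occurrence strictly after [k]. *)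
have [l [kl _ lk]] := mem_window (k + 1) (ii k).
have [|d [_ dk neq]] := @next_letter k l _ lk; first by lia.
exact: abutters_sum dk neq.
Qed.

End RepetitionQuiver.

End WeylGroup.

(** * Commutation classes, Dynkin types and the conclusion *)

Lemma commutation_equiv_act (I : finType) (adj : rel I)
  (adj_sym : symmetric adj) (u v : seq I) : commutation_equiv adj u v ->
  word_act adj u = word_act adj v /\ size u = size v.
Proof.
elim=> // {}u {}v i j t nij _ [<- <-]; split; last by rewrite !size_cat.
rewrite !word_act_cat; apply/funext => x /=; congr (word_act adj u _).
by rewrite simple_refl_comm // adj_sym.
Qed.

Lemma ade_edge_irr X a : ade_wf X -> ade_edge X a a = false.
Proof. by case: X => n /=; lia. Qed.

Lemma simply_laced_dynkin_simple (I : finType) (adj : rel I) :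
  simply_laced_dynkin adj -> symmetric adj /\ irreflexive adj.
Proof.
move=> [X [wfX [f [_ adjE]]]]; split=> [i j|i]; rewrite !adjE /ade_adj.
  by rewrite orbC.
by rewrite ade_edge_irr.
Qed.

Theorem corollary6p8 (I : finType) (adj : rel I)
  (dynkin_adj : simply_laced_dynkin adj)
  (not_A1 : ~ has_type adj (TypeA 1))
  (w0 : root_lattice I -> root_lattice I) (w0_longest : longest adj w0)
  (C : set (seq I)) (C_class : commutation_class adj w0 C)
  (w : seq I) (w_in_C : C w)
  (ii : int -> I) (ii_ext : extension adj w0 w ii)
  (x : root_lattice I * int) (x_vertex : signed_roots adj x) :
  x.1 + (succ_vertex adj w ii x).1 = \sum_(y \in abutters adj w ii x) y.1.
Proof.
have [adj_sym adj_irr] := simply_laced_dynkin_simple dynkin_adj.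
have [w1 [w1_act w1_min] CE] := C_class.
have [w_act w_size] : word_act adj w = w0 /\ size w = size w1.
  move: w_in_C; rewrite CE => /(commutation_equiv_act adj_sym)[<- <-].
  by rewrite w1_act.
have w_red : len adj w = size w.
  apply/eqP; rewrite eqn_leq len_size w_size.
  by have [v <- vw] := lenP adj w; rewrite w1_min // vw.
(* A shortest word for [act u] is reduced, so the maximality in [longest] applies to it. *)
have w_max u : (len adj u <= len adj w)%N.
  have [v vu actv] := lenP adj u; rewrite -vu w_red w_size.
  case: w0_longest => _ /(_ (word_act adj u)); apply=> //; split=> // v' actv'.
  by rewrite vu; apply: len_min.
move: ii_ext; rewrite -w_act => ii_ext.
exact: (signed_roots_mesh adj_sym adj_irr w_red w_max ii_ext).
Qed.
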